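(* Let $G=(V\cup\{m\},E)$ and $G'=(V'\cup\{m'\},E')$ be comparability graphs with disjoint vertex sets such that $m$ is not a source with respect to any transitive orientation of $G$. If the split recomposition $G\ast G'$ is a comparability graph, then $m'$ is adjacent to every vertex of $V'$ in $G'$.
   Context: All graphs are finite, simple and connected. A comparability graph is a graph admitting a transitive orientation ($\overrightarrow{ab},\overrightarrow{bc}$ imply $\overrightarrow{ac}$); a source is a vertex of in-degree zero. Split recomposition: $G\ast G'$ has vertex set $V\cup V'$ and edges: those of $G[V]$, those of $G'[V']$, and all $\overline{ab}$ with $a\in N_G(m)$, $b\in N_{G'}(m')$. *)

(* Defs.v *)
From HB Require Import structures.
From mathcomp Require Import all_boot.

Set Implicit Arguments.
Unset Strict Implicit.
Unset Printing Implicit Defensive.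

Record sgraph := SGraph {
  vertex :> finType;
  adj : rel vertex;
  adj_sym : symmetric adj;
  adj_irr : irreflexive adj
}.
Arguments adj {s} _ _ : rename.

Definition connected_graph (G : sgraph) : Prop :=
  forall x y : G, connect adj x y.

(* [r x y] reads "the edge xy is oriented from x to y"; each edge receives
   exactly one direction. *)
Definition orientation (G : sgraph) (r : rel G) : Prop :=
  (forall x y : G, r x y -> adj x y)
  /\ (forall x y : G, adj x y -> r x y (+) r y x).

Definition transitive_orientation (G : sgraph) (r : rel G) : Prop :=
  orientation r /\ transitive r.

Definition comparability_graph (G : sgraph) : Prop :=
  exists r : rel G, transitive_orientation r.

Definition indegree (G : sgraph) (r : rel G) (x : G) : nat :=
  #|[set y : G | r y x]|.

Definition source (G : sgraph) (r : rel G) (x : G) : Prop :=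
  indegree r x = 0.

(* V and V' are the vertices other than the markers m and m'; the sum type
   makes their union disjoint. *)
Definition recomp_vertex (G G' : sgraph) (m : G) (m' : G') : finType :=
  ({x : G | x != m} + {x' : G' | x' != m'})%type.

Definition recomp_adj (G G' : sgraph) (m : G) (m' : G') :
    rel (recomp_vertex m m') :=
  fun u v => match u, v with
  | inl a, inl b => adj (val a) (val b)
  | inr a, inr b => adj (val a) (val b)
  | inl a, inr b => adj m (val a) && adj m' (val b)
  | inr b, inl a => adj m (val a) && adj m' (val b)
  end.

Lemma recomp_adj_sym (G G' : sgraph) (m : G) (m' : G') :
  symmetric (@recomp_adj G G' m m').
Proof. by case=> [a|a] [b|b] //=; rewrite adj_sym. Qed.

Lemma recomp_adj_irr (G G' : sgraph) (m : G) (m' : G') :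
  irreflexive (@recomp_adj G G' m m').
Proof. by case=> a /=; rewrite adj_irr. Qed.

Definition split_recomposition (G G' : sgraph) (m : G) (m' : G') : sgraph :=
  SGraph (@recomp_adj_sym G G' m m') (@recomp_adj_irr G G' m m').

(* Main.v *)
(* If m' is not adjacent to all of V', connectedness of G' gives an edge bc with
   b adjacent to m' and c not. In G * G' the vertex b together with V induces a
   copy of G in which b plays the role of m. Every a in N(m) is adjacent to b
   but not to c, so transitivity forces ab to be oriented like cb: all edges of
   this copy at b point the same way, and b is a source after reversing the
   orientation if necessary. *)
Require Import Defs.
From mathcomp Require Import all_boot.

Set Implicit Arguments.
Unset Strict Implicit.

Lemma transitive_orientation_rev (G : sgraph) (r : rel G) :
  transitive_orientation r -> transitive_orientation (fun x y => r y x).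
Proof.
case=> [[sub tot] tr]; split; first split.
- by move=> x y /sub; rewrite adj_sym.
- by move=> x y /tot; rewrite addbC.
- by move=> y x z ryx rzy; apply: tr rzy ryx.
Qed.

Lemma transitive_orientation_induced (G H : sgraph) (f : H -> G) (r : rel G) :
  {mono f : x y / adj x y} -> transitive_orientation r ->
  transitive_orientation (relpre f r).
Proof.
move=> adjf [[sub tot] tr]; split; first split.
- by move=> x y /= /sub; rewrite adjf.
- by move=> x y xy /=; apply: tot; rewrite adjf.
- by move=> y x z /=; apply: tr.
Qed.

(** If the two edges at [b] disagreed, they would form a directed path a → b → c or c → b → a, and
    transitivity would create the missing edge [ac]. *)
Lemma orientation_forced (G : sgraph) (r : rel G) (a b c : G) :
  transitive_orientation r -> adj a b -> adj c b -> ~~ adj a c ->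
  r a b = r c b.
Proof.
case=> [[sub tot] tr] /tot ab /tot cb nac.
have nr x y : r x y -> r y x -> false.
  by move=> rxy ryx; have := sub _ _ (tr _ _ _ rxy ryx); rewrite adj_irr.
case rab: (r a b) ab; case rcb: (r c b) cb => //= rbc rba.
- by rewrite (sub _ _ (tr _ _ _ rab rbc)) in nac.
- by rewrite adj_sym (sub _ _ (tr _ _ _ rcb rba)) in nac.
Qed.

Lemma sourceP (G : sgraph) (r : rel G) (x : G) :
  (forall y, ~~ r y x) -> source r x.
Proof. by move=> nr; apply: eq_card0 => y; rewrite inE; apply: negbTE. Qed.

(** Without such an edge [bc], the closed neighbourhood of [m] would be closed under adjacency, so
    by connectedness it would contain [x]. *)
Lemma connected_dist2 (G : sgraph) (m x : G) :
  connected_graph G -> x != m -> ~~ adj m x ->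
  exists b c, [/\ adj m b, adj c b, c != m & ~~ adj m c].
Proof.
move=> conn xm nmx.
have [/existsP[b /existsP[c /and4P[]]]|no] := boolP [exists b, exists c,
    [&& adj m b, adj c b, c != m & ~~ adj m c]]; first by exists b, c.
have cl : closed adj [pred y | (y == m) || adj m y].
  apply: intro_closed; first exact/sym_connect_sym/adj_sym.
  move=> y z yz; rewrite !inE => /predU1P[ym|my].
    by rewrite -ym yz orbT.
  apply: contraR no; rewrite negb_or => /andP[zm nmz].
  by apply/existsP; exists y; apply/existsP; exists z; rewrite my adj_sym yz zm.
have := closed_connect cl (conn m x).
by rewrite !inE eqxx (negbTE xm) (negbTE nmx).
Qed.

Section MarkerCopy.

Variables (G G' : sgraph) (m : G) (m' : G') (b : {x' : G' | x' != m'}).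
Hypothesis mb : adj m' (val b).

(** [insub] fails exactly at [m], so [b] takes the place of the marker. *)
Definition marker_copy (x : G) : split_recomposition m m' :=
  if insub x is Some u then inl u else inr b.

Lemma marker_copy_marker : marker_copy m = inr b.
Proof. by rewrite /marker_copy insubF ?eqxx. Qed.

(** By [mb], the cross-adjacency condition at [b] reduces to adjacency to [m] in [G]. *)
Lemma marker_copy_adj : {mono marker_copy : x y / adj x y}.
Proof.
move=> x y; rewrite /marker_copy.
case: insubP => [u _ ux|/negPn/eqP->]; case: insubP => [v _ vy|/negPn/eqP->] /=.
- by rewrite ux vy.
- by rewrite ux mb andbT adj_sym.
- by rewrite vy mb andbT.
- by rewrite !adj_irr.
Qed.

(** Cross edges reach only neighbours of [m']. The case x = m is excluded because its image [b] may
    be adjacent to [c]. *)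
Lemma marker_copy_nadj (x : G) (c : {x' : G' | x' != m'}) :
  x != m -> ~~ adj m' (val c) -> ~~ adj (marker_copy x) (inr c).
Proof.
by move=> xm nmc; rewrite /marker_copy insubT /= (negbTE nmc) andbF.
Qed.

End MarkerCopy.

Theorem theorem9 (G G' : sgraph) (m : G) (m' : G')
    (connG : connected_graph G) (connG' : connected_graph G')
    (compG : comparability_graph G) (compG' : comparability_graph G')
    (m_not_source :
       forall r : rel G, transitive_orientation r -> ~ source r m)
    (compGG' : comparability_graph (split_recomposition m m')) :
  forall x : G', x != m' -> adj m' x.
Proof.
move=> x xm; apply/negPn/negP => nmx.
have [b0 [c0 [mb cb cm nmc]]] := connected_dist2 connG' xm nmx.
have bm : b0 != m' by apply: contraTneq mb => ->; rewrite adj_irr.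
pose b : {x' : G' | x' != m'} := Sub b0 bm.
pose c : {x' : G' | x' != m'} := Sub c0 cm.
have [r tor] := compGG'; have [[sub tot] _] := tor.
pose f := marker_copy m b.
have adjf : {mono f : y z / adj y z} by apply: marker_copy_adj.
have fm : f m = inr b := marker_copy_marker m b.
have tof := transitive_orientation_induced adjf tor.
(* The right-hand side does not depend on [y]: the single edge [cb] decides the direction of all
   edges at [f m] within the copy. *)
have forced y : adj y m -> r (f y) (f m) = r (inr c) (f m).
  move=> ym; apply: orientation_forced => //; first by rewrite adjf.
    by rewrite fm.
  apply: marker_copy_nadj => //.
  by apply: contraTneq ym => ->; rewrite adj_irr.
(* If [cb] points into [b], all edges of the copy at [b] enter it, and reversal makes [m] a source;
   otherwise none enters and [m] is already one. *)
have [rc|nrc] := boolP (r (inr c) (f m)).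
  apply: (m_not_source _ (transitive_orientation_rev tof)).
  apply: sourceP => y /=; apply/negP => rmy.
  have ym : adj y m by rewrite adj_sym -adjf sub.
  have : adj (f y) (f m) by rewrite adjf.
  by move/tot; rewrite rmy forced // rc.
apply: (m_not_source _ tof); apply: sourceP => y /=.
apply: contra nrc => rym.
by rewrite -(forced y) // -adjf sub.
Qed.
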